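(* For every $L>1$ there exists a translation-invariant distance $d$ on $\mathbb{R}$ that is $L$-biLipschitz equivalent to the Euclidean distance but such that $(\mathbb{R},d)$ does not satisfy BCP (the Besicovitch Covering Property).
   Context: A distance $d$ on $\mathbb{R}$ is translation-invariant if $d(x,y)=d(x+v,y+v)$ for all $x,y,v\in\mathbb{R}$. It is $L$-biLipschitz equivalent to the Euclidean distance if $L^{-1}|x-y|\le d(x,y)\le L|x-y|$ for all $x,y\in\mathbb{R}$. A metric space $X$ satisfies BCP if there exists an integer $N$ such that for every family of closed balls $\mathcal{A}=\{A=\overline{B}(x_A,r_A)\}$ (each ball $A$ coming with a specified center $x_A$ and radius $r_A>0$) such that $\{x_A : A\in\mathcal{A}\}$ is a bounded set, one can find a subfamily $\mathcal{A}'\subset\mathcal{A}$ that covers the centers $x_A$, $A\in\mathcal{A}$, and such that every point of $X$ belongs to at most $N$ balls of $\mathcal{A}'$. *)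

(* Defs.v *)
From HB Require Import structures.
From mathcomp Require Import all_boot all_order all_algebra.
From mathcomp Require Import all_classical all_reals.

Set Implicit Arguments.
Unset Strict Implicit.
Unset Printing Implicit Defensive.
Import Order.TTheory GRing.Theory Num.Theory.

Local Open Scope classical_set_scope.
Local Open Scope ring_scope.

(* A distance is an unbundled function rather than a [metricType]: several
   distances are considered on one carrier, which for the real line already has
   a canonical metric structure. *)
Definition is_distance (R : realType) (T : Type) (d : T -> T -> R) : Prop :=
  [/\ forall x y, 0 <= d x y,
      forall x y, d x y = 0 <-> x = y,
      forall x y, d x y = d y x
    & forall x y z, d x z <= d x y + d y z].

Definition translation_invariant (R : realType) (d : R -> R -> R) : Prop :=
  forall x y v, d x y = d (x + v) (y + v).

Definition biLipschitz_euclidean (R : realType) (L : R) (d : R -> R -> R) :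
    Prop :=
  forall x y, L^-1 * `|x - y| <= d x y /\ d x y <= L * `|x - y|.

Definition dist_cball (R : realType) (T : Type) (d : T -> T -> R)
    (x : T) (r : R) : set T :=
  [set y | d x y <= r].

Definition dist_bounded (R : realType) (T : Type) (d : T -> T -> R)
    (S : set T) : Prop :=
  exists M : R, forall x y, S x -> S y -> d x y <= M.

(* A family of balls is a set [F] of subsets of [T]; since a ball, as a set, may
   have several centers and radii, the specified ones are given by the functions
   [c] and [r], whose values outside [F] are irrelevant. *)
Definition BCP (R : realType) (T : Type) (d : T -> T -> R) : Prop :=
  exists N : nat,
    forall (F : set (set T)) (c : set T -> T) (r : set T -> R),
      (forall A, F A -> 0 < r A /\ A = dist_cball d (c A) (r A)) ->
      dist_bounded d (c @` F) ->
      exists F' : set (set T),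
        [/\ F' `<=` F,
            c @` F `<=` \bigcup_(A in F') A
          & forall x : T, ([set A | F' A /\ A x] #<= `I_N)%card].

(* Main.v *)
Require Import Defs.
From HB Require Import structures.
From mathcomp Require Import all_boot all_order all_algebra.
From mathcomp Require Import all_classical all_reals.
From mathcomp Require Import lra.

Import Order.TTheory GRing.Theory Num.Theory.
Local Open Scope classical_set_scope.
Local Open Scope ring_scope.

(** Not satisfying BCP only requires, for every [N], more than [N] balls through
    a common point none of which contains the center of another: any subfamily
    covering the centers is then the whole family
    ([not_BCP_of_mutually_avoiding_balls]).

    Take [d x y = f (x - y)] with [f] even and subadditive, the common point [0]
    and centers [s_0 < s_1 < ...]. Balls just large enough to reach [0] avoid
    each other's centers when [f (s_j - s_i) > f s_j] for [i < j] and [f s_j]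
    increases with [j]. So [f] must dip at each [s_j], at scales much smaller
    than [s_j], although it stays between [|x|] and [L |x|].

    Such an [f] is the largest subadditive function with [f x <= L |x|] and
    [f (+-s_j) <= b_j s_j], where [L >= b_0 > b_1 > ... > 1]: the infimum of the
    costs of the ways of reaching [x] by steps, each step [t] costing [L |t|], or
    [b_j s_j] if [|t| = s_j]. Being an infimum over concatenable routes makes it
    subadditive, and prices of at least [|t|] for [t] make it at least [|x|], so
    that only the dips have to be examined.

    Consider a route to [s_j - s_i]. If it contains a step of length at least
    [s_j], that step costs at least [b_j s_j] and misses the target by at least
    [s_i], which costs at least [s_i] more. Otherwise all its steps are paid at a
    rate of [b_(j-1)] or higher, so its cost is at least [b_(j-1) (s_j - s_i)],
    and this exceeds [b_j s_j] as soon as [s_j] is large compared with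
    [s_(j-1) >= s_i]. It is for this second case that the rates [b_j] decrease
    strictly: with a constant rate, [s_j - s_i] could itself be a multiple of
    [s_i] reached at that rate. [route_threshold] is this dichotomy and
    [dip_lt_length] its consequence. *)

(** * Routes and the length they induce *)

Section Routes.
Context {R : realType}.
Implicit Types (price : R -> R -> Prop) (t p x y c : R).

(** [route price x c]: the point [x] is reached from [0] by steps of total cost
    [c]. The price is a relation because one step may be sold at several prices,
    of which the infimum below retains the cheapest. *)
Inductive route price : R -> R -> Prop :=
| route_nil : route price 0 0
| route_cons t p x c :
    price t p -> route price x c -> route price (t + x) (p + c).

Definition length price x : R := inf [set c | route price x c].

Definition length_dist price x y : R := length price (x - y).

Lemma route_step price t p : price t p -> route price t p.
Proof.
by move=> tp; rewrite -[t]addr0 -[p]addr0; apply: route_cons tp (route_nil _).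
Qed.

Lemma route_cat price x y c c' :
  route price x c -> route price y c' -> route price (x + y) (c + c').
Proof.
elim=> [|t p x1 c1 tp _ IH] yc'; first by rewrite !add0r.
by rewrite -!addrA; apply: route_cons tp (IH yc').
Qed.

Lemma route_opp price x c : (forall t p, price t p -> price (- t) p) ->
  route price x c -> route price (- x) c.
Proof.
move=> priceN; elim=> [|t p x1 c1 tp _ IH].
  by rewrite oppr0; apply: route_nil.
by rewrite opprD; apply: route_cons (priceN _ _ tp) IH.
Qed.

Lemma route_ge_norm price x c : (forall t p, price t p -> `|t| <= p) ->
  route price x c -> `|x| <= c.
Proof.
move=> price_ge; elim=> [|t p x1 c1 tp _ IH]; first by rewrite normr0.
by rewrite (le_trans (ler_normD _ _))// lerD// price_ge.
Qed.

(** Either all the steps are shorter than [s], and the rate [w] applies to each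
    of them, or one of them is a long step [t]: then the rest of the route has to
    make up the distance from [t] to the endpoint, at unit rate or more. *)
Lemma route_threshold price s w v x c :
  (forall t p, price t p -> `|t| <= p) ->
  (forall t p, price t p -> `|t| < s -> w * `|t| <= p) ->
  (forall t p, price t p -> s <= `|t| -> v <= p) ->
  0 <= w -> route price x c ->
  w * `|x| <= c \/ exists2 t, s <= `|t| & v + `|x - t| <= c.
Proof.
move=> price_ge short long w0; elim=> [|t p x1 c1 tp x1c1 IH].
  by left; rewrite normr0 mulr0.
have [st|ts] := leP s `|t|.
  right; exists t => //; rewrite addrAC subrr add0r.
  by rewrite lerD ?(long _ _ tp st)// (route_ge_norm _ _ _ price_ge x1c1).
case: IH => [IH|[u su IH]].
  left; rewrite (le_trans (ler_wpM2l w0 (ler_normD _ _)))// mulrDr lerD//.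
  exact: short.
right; exists u => //; rewrite -addrA.
have := price_ge _ _ tp; have := ler_normD t (x1 - u); lra.
Qed.

Section LengthDist.
Variables (L : R) (price : R -> R -> Prop).
Hypothesis price_ge : forall t p, price t p -> `|t| <= p.
Hypothesis priceN : forall t p, price t p -> price (- t) p.
Hypothesis price_lin : forall t, price t (L * `|t|).

Lemma length_le_route x c : route price x c -> length price x <= c.
Proof.
move=> xc; apply: ge_inf => //; exists 0 => c' /(route_ge_norm _ _ _ price_ge).
exact: le_trans.
Qed.

Lemma length_ge x b :
  (forall c, route price x c -> b <= c) -> b <= length price x.
Proof.
move=> xb; apply: lb_le_inf => [|c /xb//].
by exists (L * `|x|); apply/route_step/price_lin.
Qed.

Lemma length_ge_norm x : `|x| <= length price x.
Proof. by apply: length_ge => c; apply: route_ge_norm. Qed.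

Lemma lengthN x : length price (- x) = length price x.
Proof.
apply/eqP; rewrite eq_le; apply/andP; split; apply: length_ge => c xc.
  by apply: length_le_route; apply: route_opp.
by apply: length_le_route; rewrite -[x]opprK; apply: route_opp.
Qed.

Lemma lengthD x y : length price (x + y) <= length price x + length price y.
Proof.
rewrite -lerBlDr; apply: length_ge => c xc.
rewrite lerBlDr -lerBlDl; apply: length_ge => c' yc'.
by rewrite lerBlDl; apply: length_le_route; apply: route_cat.
Qed.

Lemma length_dist_is_distance : is_distance (length_dist price).
Proof.
split=> [x y|x y|x y|x y z].
- exact: le_trans (length_ge_norm _).
- split=> [xy|->].
    apply/eqP; rewrite -subr_eq0 -normr_le0 -xy; exact: length_ge_norm.
  rewrite /length_dist subrr; apply/eqP; rewrite eq_le length_le_route /=.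
    exact: le_trans (length_ge_norm _).
  exact: route_nil.
- by rewrite /length_dist -lengthN opprB.
- by rewrite /length_dist -[x - z](subrKA y); apply: lengthD.
Qed.

Lemma length_dist_invariant : translation_invariant (length_dist price).
Proof. by move=> x y v; rewrite /length_dist [y + v]addrC addrKA. Qed.

Lemma length_dist_biLipschitz :
  1 <= L -> biLipschitz_euclidean L (length_dist price).
Proof.
move=> L1 x y; split; last exact/length_le_route/route_step/price_lin.
apply: le_trans (length_ge_norm _); rewrite ler_piMl// invf_le1//.
exact: lt_le_trans L1.
Qed.

End LengthDist.
End Routes.

(** * An obstruction to the Besicovitch covering property *)

(** A center is covered by its own ball only, so a covering subfamily of the
    first [N + 1] balls contains them all, and [z] lies in each of them. The
    sequence is infinite so as to serve every [N] at once. *)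
Lemma not_BCP_of_mutually_avoiding_balls (R : realType) (T : Type)
    (d : T -> T -> R) (x : nat -> T) (r : nat -> R) (z : T) :
  is_distance d -> (forall i, 0 < r i) -> (forall i, d (x i) z <= r i) ->
  (forall i j, i <> j -> r i < d (x i) (x j)) -> ~ BCP d.
Proof.
move=> [d_ge0 d0P dC dT] r0 xz avoid [N bcp].
pose B i := dist_cball d (x i) (r i).
have BxP i j : B i (x j) <-> i = j.
  split=> [|->]; last by rewrite /B /dist_cball /= (iffRL (d0P _ _)) ?ltW.
  by move=> Bixj; apply: contrapT => /avoid; rewrite ltNge Bixj.
have B_inj : injective B.
  by move=> i j Bixj; apply/BxP; rewrite Bixj; apply/BxP.
(* Distinct indices give distinct sets, so that a center and a radius can be
   read off a ball as a set. *)
pose idx A := xget 0%N [set i | A = B i].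
have idxK i : idx (B i) = i.
  by apply/B_inj/esym/(@xgetI _ 0%N [set j | B i = B j] i).
have [] := bcp (B @` `I_N.+1) (x \o idx) (r \o idx).
- by move=> _ [i _ <-] /=; rewrite idxK.
- exists (\sum_(i < N.+1) r i + \sum_(i < N.+1) r i).
  have r_le i : (i < N.+1)%N -> r i <= \sum_(i < N.+1) r i.
    move=> iN; rewrite (bigD1 (Ordinal iN))//= lerDl sumr_ge0// => k _.
    exact: ltW.
  move=> _ _ [_ [i iN <-] <-] [_ [j jN <-] <-] /=; rewrite !idxK.
  rewrite (le_trans (dT _ z _))// lerD//.
    exact: le_trans (r_le _ iN).
  by rewrite dC; exact: le_trans (r_le _ jN).
- move=> F' [F'F cover /(_ z) mult].
  have F'B i : `I_N.+1 i -> F' (B i).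
    move=> iN; have [|A F'A] := cover (x i).
      by exists (B i); [exists i|rewrite /= idxK].
    by have [j _ jA] := F'F _ F'A; rewrite -jA => /BxP <-; rewrite jA.
  suff: (`I_N.+1 #<= `I_N)%card by rewrite card_le_II ltnn.
  apply: card_le_trans mult.
  have : (B @` `I_N.+1 #= `I_N.+1)%card.
    by apply: inj_card_eq => i j _ _; apply: B_inj.
  rewrite card_eq_le => /andP[_ le_IB].
  apply: card_le_trans le_IB _; apply: subset_card_le.
  move=> _ [i iN <-]; split; [exact: F'B|exact: xz].
Qed.

(** * A length that dips along a sequence of scales *)

Section DippedLength.
Context {R : realType}.
Variable L : R.
Hypothesis L_gt1 : 1 < L.

Definition weight (j : nat) : R := 1 + (L - 1) / 2 ^+ j.

(** The summand [L / (weight i - weight i.+1)] makes the drop in weight at scale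
    [i.+1] outweigh the whole cost of scale [i]; the summand [L] makes the prices
    [weight i * scale i] increase although the weights decrease. *)
Fixpoint scale (j : nat) : R :=
  if j is i.+1 then (L + L / (weight i - weight i.+1)) * scale i else 1.

Definition dipped_price (t p : R) : Prop :=
  p = L * `|t| \/ exists2 j, `|t| = scale j & p = weight j * scale j.

Lemma weightP j : [/\ 1 < weight j.+1, weight j.+1 < weight j & weight j <= L].
Proof.
rewrite /weight exprS invfM mulrCA.
set e := (L - 1) / 2 ^+ j.
have e0 : 0 < e by rewrite divr_gt0 ?subr_gt0 ?exprn_gt0.
have : e <= L - 1.
  rewrite /e ler_pdivrMr ?exprn_gt0// ler_peMr ?subr_ge0 ?(ltW L_gt1)//.
  by rewrite exprn_ege1 ?ler1n.
by split; lra.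
Qed.

Lemma weight_gt1 j : 1 < weight j.
Proof. by have [w1 w_lt _] := weightP j; apply: lt_trans w_lt. Qed.

Lemma weight_le i j : (i <= j)%N -> weight j <= weight i.
Proof.
by apply: Order.NatMonotonyTheory.nonincnP => k; have [_ /ltW] := weightP k.
Qed.

Lemma scaleP j :
  [/\ weight j * scale j < (weight j - weight j.+1) * scale j.+1,
      L * scale j < scale j.+1 & 0 < scale j].
Proof.
have [w1 w_lt wL] := weightP j.
have gap0 : 0 < weight j - weight j.+1 by rewrite subr_gt0.
have L0 : 0 < L := lt_trans ltr01 L_gt1.
have s0 : 0 < scale j.
  elim: j {w1 w_lt wL gap0} => [//|i s0] /=.
  have [_ w_lt _] := weightP i.
  by rewrite mulr_gt0// addr_gt0// divr_gt0// subr_gt0.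
split=> //=.
  rewrite mulrA ltr_pM2r// mulrDr mulrCA divff ?lt0r_neq0// mulr1.
  rewrite (le_lt_trans wL)// ltrDr mulr_gt0//.
by rewrite ltr_pM2r// ltrDl divr_gt0.
Qed.

Lemma scale_gt0 j : 0 < scale j.
Proof. by case: (scaleP j). Qed.

Lemma scale_lt : {homo scale : i j / (i < j)%N >-> i < j}.
Proof.
apply: homo_ltn => [y x z|j]; first exact: lt_trans.
have [_ sS s0] := scaleP j.
by apply: lt_trans sS; rewrite ltr_pMl.
Qed.

Lemma scale_le : {homo scale : i j / (i <= j)%N >-> i <= j}.
Proof.
by move=> i j; rewrite leq_eqVlt => /predU1P[->//|/scale_lt/ltW].
Qed.

Lemma dip_lt :
  {homo (fun j => weight j * scale j) : i j / (i < j)%N >-> i < j}.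
Proof.
apply: homo_ltn => [y x z|j]; first exact: lt_trans.
have [_ sS s0] := scaleP j.
have [_ _ wL] := weightP j.
rewrite (@le_lt_trans _ _ (L * scale j)) ?ler_pM2r// (lt_le_trans sS)//.
by rewrite ler_peMl ?ltW ?weight_gt1 ?scale_gt0.
Qed.

Lemma dipped_price_ge t p : dipped_price t p -> `|t| <= p.
Proof.
by case=> [->|[j -> ->]]; rewrite ler_peMl// ltW// ?weight_gt1 ?scale_gt0.
Qed.

Lemma dipped_priceN t p : dipped_price t p -> dipped_price (- t) p.
Proof. by rewrite /dipped_price normrN. Qed.

Lemma dipped_price_lin t : dipped_price t (L * `|t|).
Proof. by left. Qed.

(** Steps shorter than [scale j.+1] can use only the rates [L] and
    [weight m] with [m <= j]. *)
Lemma dipped_price_short j t p :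
  dipped_price t p -> `|t| < scale j.+1 -> weight j * `|t| <= p.
Proof.
case=> [->|[m -> ->]] ts; first by rewrite ler_wpM2r//; case: (weightP j).
rewrite ler_pM2r ?scale_gt0//; apply: weight_le.
by rewrite leqNgt; apply/negP => /scale_le; rewrite leNgt ts.
Qed.

Lemma dipped_price_long j t p :
  dipped_price t p -> scale j <= `|t| -> weight j * scale j <= p.
Proof.
case=> [->|[m -> ->]] ts.
  have [_ _ wL] := weightP j; apply: ler_pM => //; last exact/ltW/scale_gt0.
  exact/ltW/(lt_trans ltr01)/weight_gt1.
case: (leqP j m) => [|/scale_lt]; last by rewrite ltNge ts.
by rewrite leq_eqVlt => /predU1P[->|/dip_lt/ltW].
Qed.

(** The length function has a dip at [scale j]: it is larger at all the points
    [scale j - scale i], although they are closer to [0]. *)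
Lemma dip_lt_length i j : (i < j)%N ->
  weight j * scale j < length dipped_price (scale j - scale i).
Proof.
case: j => // j; rewrite ltnS => ij.
have [gap _ _] := scaleP j.
have si0 := scale_gt0 i; have sj0 := scale_gt0 j.
have w0 : 0 < weight j := lt_trans ltr01 (weight_gt1 j).
have sij : scale i <= scale j by apply: scale_le.
have sjS : scale j < scale j.+1 by apply: scale_lt.
have wij : weight j * scale i <= weight j * scale j by rewrite ler_pM2l.
(* The bound has to be strict for an infimum, hence the uniform lower bound by
   the smaller of the two values of the dichotomy. *)
apply: (@lt_le_trans _ _ (Num.min (weight j * (scale j.+1 - scale i))
                                  (weight j.+1 * scale j.+1 + scale i))).
  by rewrite lt_min ltrDl si0 andbT; lra.
apply: (length_ge _ _ dipped_price_lin) => c rc.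
have [|||le_c|[t st le_c]] := route_threshold dipped_price (scale j.+1)
  (weight j) (weight j.+1 * scale j.+1) _ c dipped_price_ge _ _ _ rc.
- exact: dipped_price_short.
- exact: dipped_price_long.
- exact: ltW.
- by rewrite ge_min (le_trans _ le_c)// ger0_norm// subr_ge0; lra.
- rewrite ge_min; apply/orP; right; apply: le_trans le_c; rewrite lerD2l.
  (* A step of length at least [scale j.+1] overshoots [scale j.+1 - scale i] by
     at least [scale i]. *)
  have := ler_normB (scale j.+1 - scale i) (scale j.+1 - scale i - t).
  rewrite opprB addrC subrK [`|scale j.+1 - _|]ger0_norm; lra.
Qed.

End DippedLength.

Theorem theorem1p9 (R : realType) (L : R) (hL : 1 < L) :
  exists d : R -> R -> R,
    [/\ is_distance d,
        translation_invariant d,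
        biLipschitz_euclidean L d
      & ~ BCP d].
Proof.
pose price := dipped_price L; exists (length_dist price).
have price_ge := dipped_price_ge L hL; have priceN := dipped_priceN L.
have price_lin := dipped_price_lin L.
have d_dist : is_distance (length_dist price).
  exact: length_dist_is_distance price_ge priceN price_lin.
split=> //.
- exact: length_dist_invariant.
- exact: length_dist_biLipschitz price_ge price_lin (ltW hL).
apply: (not_BCP_of_mutually_avoiding_balls _ _ _ (scale L)
          (fun i => weight L i * scale L i) 0 d_dist).
- by move=> i; rewrite mulr_gt0 ?scale_gt0// (lt_trans _ (weight_gt1 _ hL i)).
- move=> i; rewrite /length_dist subr0; apply: length_le_route price_ge _ _ _.
  apply: route_step; right; exists i => //.
  by rewrite ger0_norm// ltW// scale_gt0.
- move=> i j /eqP; rewrite neq_ltn => /orP[] ij.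
    rewrite /length_dist -opprB (lengthN L)//.
    apply: lt_trans (dip_lt_length _ hL _ _ ij); exact: dip_lt.
  exact: dip_lt_length.
Qed.
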